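(* Let $K$ be a compact Hausdorff space and let $H$ be a complex Hilbert space. Suppose $t_0\in K$ and $x_0\in S(H)$. Then every element in $A(t_0,x_0)$ can be approximated in norm by a finite convex combination of elements in $A(t_0,x_0)\cap \partial_{e}(\mathcal{B}_{C(K,H)})$.
   Context: $C(K,H)$ is the Banach space of all continuous functions from $K$ to $H$, with the supremum norm. For a Banach space $X$, $S(X)$ is its unit sphere and $\mathcal{B}_X$ its closed unit ball; $\partial_e(L)$ is the set of extreme points of a convex set $L$. For $t_0\in K$ and $x_0\in S(H)$, $A(t_0,x_0):=\{ a\in S(C(K,H)) : a(t_0) = x_0\}$. ''Can be approximated in norm'' means: for every $\varepsilon>0$ there is such a convex combination at distance less than $\varepsilon$. *)

(* Defs.v *)
From HB Require Import structures.
From mathcomp Require Import all_boot all_order all_algebra.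
From mathcomp Require Import sesquilinear complex.
From mathcomp Require Import all_classical all_reals all_analysis.

Set Implicit Arguments.
Unset Strict Implicit.
Unset Printing Implicit Defensive.

Import Order.TTheory GRing.Theory Num.Theory.
Import numFieldNormedType.Exports.

Local Open Scope classical_set_scope.
Local Open Scope ring_scope.

(* In the next two definitions F may be the field R[i] of complex numbers: for
   its order 0 <= z means that z is real and nonnegative, so the coefficients
   of the combinations are real even when F is complex. *)

Definition extreme_points (F : numDomainType) (E : lmodType F) (L : set E) :
    set E :=
  [set x | L x /\
    forall (y z : E) (s : F), L y -> L z -> 0 < s -> s < 1 ->
      x = s *: y + (1 - s) *: z -> y = x /\ z = x].

Definition convex_combinations (F : numDomainType) (E : lmodType F)
    (S : set E) : set E :=
  [set x | exists (n : nat) (s : 'I_n -> F) (u : 'I_n -> E),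
    [/\ forall i, 0 <= s i, \sum_(i < n) s i = 1, forall i, S (u i) &
        x = \sum_(i < n) s i *: u i]].

(* C(K, H) is represented as a set in the R[i]-module of all functions K -> H.
   Norms in H lie in R[i], where they are real, hence the projection Re. The
   library's sup has the value 0 on empty or unbounded sets; supnorm is only
   used on continuous functions on a nonempty compact space. *)

Definition supnorm (R : realType) (K : topologicalType)
    (H : normedModType R[i]) (f : K -> H) : R :=
  sup [set complex.Re `|f t| | t in [set: K]].

Definition cont_functions (R : realType) (K : topologicalType)
    (H : normedModType R[i]) : set (K -> H) :=
  [set f | continuous f].

Definition cont_ball (R : realType) (K : topologicalType)
    (H : normedModType R[i]) : set (K -> H) :=
  [set f | cont_functions f /\ supnorm f <= 1].

Definition cont_sphere (R : realType) (K : topologicalType)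
    (H : normedModType R[i]) : set (K -> H) :=
  [set f | cont_functions f /\ supnorm f = 1].

Definition sphere_face (R : realType) (K : topologicalType)
    (H : normedModType R[i]) (t0 : K) (x0 : H) : set (K -> H) :=
  [set a | cont_sphere a /\ a t0 = x0].

(* Main.v *)
(* Fix 1/2 < l < 1.  If u is unit-valued and |a| <= 1, then g = l u + (1 - l) a
   vanishes nowhere, so with r = sqrt (|g|^-2 - 1) it is the average of the two
   continuous unit-valued functions (1 + i r) g and (1 - i r) g; all these
   functions equal x0 at t0 when u and a do.  Hence c |-> l c + (1 - l) a
   preserves the convex hull of the unit-valued functions of the face, and its
   iterates, started at the constant x0, converge geometrically to its fixed
   point a.  Unit-valued functions are extreme because H is strictly convex. *)
Require Import Defs.
From HB Require Import structures.
From mathcomp Require Import all_boot all_order all_algebra.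
From mathcomp Require Import sesquilinear complex.
From mathcomp Require Import all_classical all_reals all_analysis.
From mathcomp Require Import ring lra.

Set Implicit Arguments.
Unset Strict Implicit.
Unset Printing Implicit Defensive.

Import Order.TTheory GRing.Theory Num.Theory.
Import numFieldNormedType.Exports.

Local Open Scope classical_set_scope.
Local Open Scope ring_scope.

Lemma Re_norm_continuous (R : realType) (K : topologicalType)
    (H : normedModType R[i]) (f : K -> H) :
  continuous f -> continuous (fun t => complex.Re `|f t| : R).
Proof.
move=> fc t; apply/cvgrPdist_lt => e e0.
have e0' : (0 : R[i]) < e%:C%C by rewrite ltcR.
near=> s.
have H1 : `|f t - f s| < e%:C%C.
  by near: s; apply: cvgr_dist_lt => //; exact: fc.
rewrite -ltcR; apply: le_lt_trans H1.
apply: le_trans (ler_dist_dist _ _).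
by have := normc_ge_Re (`|f t| - `|f s|); rewrite raddfB.
Unshelve. all: by end_near.
Qed.

Lemma complex_scale_continuous (R : realType) (K : topologicalType)
    (H : normedModType R[i]) (x : R) (r : K -> R) (f : K -> H) :
  continuous r -> continuous f ->
  continuous (fun t => (x +i* r t)%C *: f t).
Proof.
move=> rc fc t; apply: cvgZ; last exact: fc.
apply/cvgrPdist_lt => e e0.
(* A positive element of [R[i]] is real, so the estimate can be made in [R]. The two scalars share
   the real part [x], so their distance is [|r t - r s|]. *)
have ee : e = (complex.Re e)%:C%C by rewrite RRe_real // gtr0_real.
have e0' : 0 < complex.Re e by rewrite -ltcR -ee.
near=> s.
have H1 : `|r t - r s| < complex.Re e.
  by near: s; apply: cvgr_dist_lt => //; exact: rc.
by rewrite normc_def /= subrr expr0n add0r sqrtr_sqr ee ltcR.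
Unshelve. all: by end_near.
Qed.

Lemma norm_complexE (R : realType) (H : normedModType R[i]) (x : H) :
  `|x| = (complex.Re `|x|)%:C%C.
Proof. by rewrite RRe_real // ger0_real. Qed.

Lemma Re_norm_has_ubound (R : realType) (K : topologicalType)
    (H : normedModType R[i]) (f : K -> H) :
  compact [set: K] -> continuous f ->
  has_ubound [set complex.Re `|f t| | t in [set: K]].
Proof.
move=> cK cf.
have cn : {within [set: K], continuous (fun t => complex.Re `|f t| : R)}.
  by apply: continuous_subspaceT => t; apply: Re_norm_continuous.
have [M [_ MP]] := compact_bounded (continuous_compact cn cK).
(* [compact_bounded] bounds the norms by every number strictly above [M], hence the [+ 1]. *)
exists (M + 1) => _ [t _ <-].
apply: le_trans (ler_norm _) _; apply: MP; first by rewrite ltrDl.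
by exists t.
Qed.

(** Compactness bounds the set of norms and [t0] makes it nonempty, so [sup] is a true supremum and
    not its default value 0. *)
Lemma supnorm_leP (R : realType) (K : topologicalType)
    (H : normedModType R[i]) (t0 : K) (f : K -> H) (c : R) :
  compact [set: K] -> continuous f ->
  supnorm f <= c <-> forall t, `|f t| <= c%:C%C.
Proof.
move=> cK cf; split=> [fc t | fc].
  rewrite norm_complexE lecR; apply: le_trans fc.
  by apply: ub_le_sup; [exact: Re_norm_has_ubound | exists t].
apply: ge_sup; first by exists (complex.Re `|f t0|), t0.
by move=> _ [t _ <-]; rewrite -lecR -norm_complexE.
Qed.

(** Conjugation fixes the real scalars [s] and [1 - s], so expanding both sides by sesquilinearity
    gives the same polynomial. The last term measures strict convexity. *)
Lemma norm_convex_comb (R : realType) (H : normedModType R[i])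
    (dotH : {dot H for (@Num.conj R[i])})
    (normH : forall x : H, `|x| ^+ 2 = dotH x x) (s : R[i]) (x y : H) :
  s \is Num.real ->
  `|s *: x + (1 - s) *: y| ^+ 2 =
    s * `|x| ^+ 2 + (1 - s) * `|y| ^+ 2 - s * (1 - s) * `|x - y| ^+ 2.
Proof.
move=> sR.
have sC : Num.conj s = s by exact/CrealP.
have sC1 : Num.conj (1 - s) = 1 - s by apply/CrealP; rewrite rpredB ?rpred1.
have nB : dotH (x - y) (x - y) = dotH x x - dotH x y - dotH y x + dotH y y.
  by rewrite linearBl !linearBr opprB addrA addrAC.
rewrite !normH nB linearDl !linearDr /= !linearZl !linearZr /= sC sC1.
ring.
Qed.

(** In [norm_convex_comb] the first two terms add up to at most 1. A left side equal to 1 thus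
    forces [s * (1 - s) * |x - y|^2 <= 0]. *)
Lemma strict_convexity (R : realType) (H : normedModType R[i])
    (dotH : {dot H for (@Num.conj R[i])})
    (normH : forall x : H, `|x| ^+ 2 = dotH x x) (s : R[i]) (x y : H) :
  0 < s -> s < 1 -> `|x| <= 1 -> `|y| <= 1 ->
  `|s *: x + (1 - s) *: y| = 1 -> x = y.
Proof.
move=> s0 s1 x1 y1 e1.
have := norm_convex_comb normH x y (gtr0_real s0).
rewrite e1 expr1n => E.
have p0 : 0 < s * (1 - s) by rewrite mulr_gt0 // subr_gt0.
have bnd : s * `|x| ^+ 2 + (1 - s) * `|y| ^+ 2 <= 1.
  rewrite [leRHS](_ : 1 = s * 1 + (1 - s) * 1); last by ring.
  by apply: lerD; apply: ler_wpM2l; rewrite ?subr_ge0 ?exprn_ile1 // ltW.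
have : `|x - y| ^+ 2 <= 0.
  by rewrite -(pmulr_rle0 _ p0) -(lerD2l 1) addr0 {1}E addrNK.
by rewrite real_exprn_even_le0 //= normr_eq0 subr_eq0 => /eqP.
Qed.

Definition unit_face (R : realType) (K : topologicalType)
    (H : normedModType R[i]) (t0 : K) (x0 : H) : set (K -> H) :=
  [set u | [/\ continuous u, forall t, `|u t| = 1 & u t0 = x0]].

(** Each value [u t] is a unit vector and a proper convex combination of [y t] and [z t] in the unit
    ball of [H], so strict convexity applies pointwise. *)
Lemma unit_face_extreme (R : realType) (K : topologicalType)
    (H : normedModType R[i]) (dotH : {dot H for (@Num.conj R[i])})
    (t0 : K) (x0 : H) :
  compact [set: K] -> (forall x : H, `|x| ^+ 2 = dotH x x) ->
  unit_face t0 x0 `<=`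
    sphere_face t0 x0 `&` extreme_points (@cont_ball R K H).
Proof.
move=> cK normH u [cu u1 ut0].
have su1 : supnorm u = 1.
  rewrite /supnorm (_ : [set _ | _ in _] = [set 1]) ?sup1 //.
  apply/seteqP; split=> [_ [t _ <-]|_ ->]; first by rewrite u1.
  by exists t0; rewrite // u1.
split; first by [].
split=> [|y z s [cy y1] [cz z1] s0 s1 uE]; first by split; rewrite ?su1.
have yz : y = z.
  apply/funext => t; apply: (strict_convexity normH s0 s1).
  - exact: (supnorm_leP t0 _ cK cy).1.
  - exact: (supnorm_leP t0 _ cK cz).1.
  - by rewrite -[RHS](u1 t) uE.
by rewrite uE -yz -scalerDl addrC subrK scale1r.
Qed.

Lemma unit_face_average (R : realType) (K : topologicalType)
    (H : normedModType R[i]) (t0 : K) (x0 : H) (g : K -> H) :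
  `|x0| = 1 -> continuous g -> (forall t, g t != 0) ->
  (forall t, `|g t| <= 1) -> g t0 = x0 ->
  exists v w, [/\ unit_face t0 x0 v, unit_face t0 x0 w &
    g = 2^-1 *: (v + w)].
Proof.
move=> x01 cg g0 g1 gt0.
pose h t : R := complex.Re `|g t|.
have h_gt0 t : 0 < h t by rewrite -ltcR -norm_complexE normr_gt0.
have h_le1 t : h t <= 1 by rewrite -lecR -norm_complexE.
pose r t : R := Num.sqrt ((h t) ^- 2 - 1).
have r2 t : r t ^+ 2 = (h t) ^- 2 - 1.
  by rewrite sqr_sqrtr // subr_ge0 invf_ge1 ?exprn_gt0 // exprn_ile1 // ltW.
have rt0 : r t0 = 0 by rewrite /r /h gt0 x01 expr1n invr1 subrr sqrtr0.
have cr : continuous r.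
  move=> t; apply: (@continuous_comp _ _ _ (fun t => h t ^- 2 - 1) Num.sqrt).
    apply: cvgB; last exact: cvg_cst.
    apply: cvgV; first by rewrite expf_eq0 /= gt_eqF.
    by apply: cvgM; exact: Re_norm_continuous.
  exact: sqrt_continuous.
(* Only [q^2 = r^2] matters, so this covers both [r] and [- r]: it gives [|1 + i q| = 1 / |g|]
   everywhere, and [q t0 = 0] because [r t0 = 0]. *)
have unit_of (q : K -> R) : continuous q -> (forall t, q t ^+ 2 = r t ^+ 2) ->
    unit_face t0 x0 (fun t => (1 +i* q t)%C *: g t).
  move=> cq q2; split.
  - exact: complex_scale_continuous.
  - move=> t; rewrite normrZ normc_def /= q2 r2 expr1n addrC subrK.
    rewrite sqrtrV ?sqr_ge0 //.
    rewrite sqrtr_sqr gtr0_norm // norm_complexE -rmorphM mulVf //.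
    by rewrite gt_eqF.
  - have /eqP := q2 t0; rewrite rt0 expr0n sqrf_eq0 => /eqP ->.
    by rewrite gt0 scale1r.
exists (fun t => (1 +i* r t)%C *: g t), (fun t => (1 +i* (- r t))%C *: g t).
split.
- exact: unit_of.
- apply: unit_of => [t|t]; last exact: sqrrN.
  by apply: cvgN; exact: cr.
apply/funext => t /=.
rewrite [RHS]/= /GRing.scale /= /GRing.add /= -scalerDl scalerA.
have -> : (1 +i* r t)%C + (1 -i* r t)%C = 2 :> R[i].
  by apply/eqP; rewrite eq_complex /= subrr addr0 !eqxx.
by rewrite mulVf ?pnatr_eq0 // scale1r.
Qed.

(** The map is affine, so it can be applied to each point of the combination. Each image is an
    average of two points of [S], which doubles the number of terms and halves the weights. *)
Lemma convex_combinations_step (F : numFieldType) (E : lmodType F) (S : set E)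
    (l : F) (f c : E) :
  (forall u, S u -> exists v w,
     [/\ S v, S w & l *: u + (1 - l) *: f = 2^-1 *: (v + w)]) ->
  convex_combinations S c -> convex_combinations S (l *: c + (1 - l) *: f).
Proof.
move=> Sf [n [s [u [s0 s1 Su ->]]]].
have /choice [vw vwP] : forall i, exists p : E * E,
    [/\ S p.1, S p.2 & l *: u i + (1 - l) *: f = 2^-1 *: (p.1 + p.2)].
  by move=> i; have [v [w P]] := Sf _ (Su i); exists (v, w).
exists (n + n)%N.
exists (fun k : 'I_(n + n) =>
  2^-1 * match fintype.split k with inl i => s i | inr i => s i end).
exists (fun k : 'I_(n + n) =>
  match fintype.split k with inl i => (vw i).1 | inr i => (vw i).2 end).
have splitl (i : 'I_n) : fintype.split (lshift n i) = inl i := unsplitK (inl i).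
have splitr (i : 'I_n) : fintype.split (rshift n i) = inr i := unsplitK (inr i).
split.
- by move=> k; case: fintype.split => i; rewrite mulr_ge0 // invr_ge0.
- rewrite -mulr_sumr big_split_ord /=.
  under eq_bigr do rewrite splitl.
  under [X in _ + X]eq_bigr do rewrite splitr.
  by rewrite s1 -[1 + 1]/(2%:R) mulVf ?pnatr_eq0.
- by move=> k; case: fintype.split => i; case: (vwP i).
rewrite big_split_ord /=.
under [X in _ = X + _]eq_bigr do rewrite splitl.
under [X in _ = _ + X]eq_bigr do rewrite splitr.
(* Since the weights sum to 1, [f] can be distributed over the terms. *)
have fE : f = \sum_(i < n) s i *: f by rewrite -scaler_suml s1 scale1r.
rewrite -big_split /= [f in LHS]fE !scaler_sumr -big_split.
apply: eq_bigr => i _ /=; have [_ _ e] := vwP i.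
by rewrite -scalerDr mulrC -scalerA -e scalerDr !scalerA ![s i * _]mulrC.
Qed.

Theorem corollary4p7 (R : realType) (K : topologicalType)
    (K_compact : compact [set: K]) (K_hausdorff : hausdorff_space K)
    (H : completeNormedModType R[i]) (dotH : {dot H for (@Num.conj R[i])})
    (normH : forall x : H, `|x| ^+ 2 = dotH x x)
    (t0 : K) (x0 : H) (x0_unit : `|x0| = 1)
    (a : K -> H) (a_face : sphere_face t0 x0 a)
    (eps : R) (eps_gt0 : 0 < eps) :
  exists b : K -> H,
    convex_combinations
      (sphere_face t0 x0 `&` extreme_points (@cont_ball R K H)) b /\
    supnorm (a - b) < eps.
Proof.
have [[ca na] at0] := a_face.
have a1 : forall t, `|a t| <= 1.
  by apply: (supnorm_leP t0 _ K_compact ca).1; rewrite na.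
(* Any constant strictly between 1/2 and 1 would do. *)
pose l : R[i] := (2 / 3)%:C%C.
have lC : 1 - l = (1 / 3)%:C%C.
  rewrite /l -[1 in LHS](rmorph1 (real_complex R)) -rmorphB.
  by congr (_%:C)%C; field.
have l0 : 0 <= l by rewrite ler0c; lra.
have lC0 : 0 <= 1 - l by rewrite lC ler0c; lra.
have lCl : 1 - l < l by rewrite lC ltcR; lra.
(* Closed form of the [n]-th iterate of [c |-> l c + (1 - l) a], started at the constant [x0]. *)
pose b n : K -> H := l ^+ n *: cst x0 + (1 - l ^+ n) *: a.
have conv_b n : convex_combinations (unit_face t0 x0) (b n).
  elim: n => [|n IH].
    rewrite /b expr0 subrr scale0r addr0 scale1r.
    exists 1%N, (fun=> 1), (fun=> cst x0); split=> //.
    - by rewrite big_ord1.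
    - by move=> i; split=> // t; exact: cvg_cst.
    - by rewrite big_ord1 scale1r.
  have -> : b n.+1 = l *: b n + (1 - l) *: a.
    rewrite /b scalerDr !scalerA -addrA -scalerDl exprS.
    by congr (_ + _ *: _); ring.
  apply: convex_combinations_step IH => u [cu u1 ut0].
  apply: unit_face_average => //.
  - move=> t; apply: cvgD; (apply: cvgZ; first exact: cvg_cst).
      exact: cu.
    exact: ca.
  (* A zero at [t] would give [l = (1 - l) * |a t| <= 1 - l], against [l > 1/2]. *)
  - move=> t; apply: contraTneq lCl => /eqP.
    rewrite addr_eq0 => /eqP; rewrite -[LHS]/(l *: u t) => e.
    have lE : l = (1 - l) * `|a t|.
      by rewrite -(ger0_norm lC0) -normrZ -normrN -e normrZ u1 mulr1 ger0_norm.
    by apply/negP => /lt_geF; rewrite [X in X <= _]lE ler_piMr.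
  - move=> t; apply: le_trans (ler_normD _ _) _.
    rewrite !normrZ (ger0_norm l0) (ger0_norm lC0) u1 mulr1 -[leRHS](subrK l).
    by rewrite addrC lerD2r -[leRHS]mulr1 ler_wpM2l.
  - rewrite -[LHS]/(l *: u t0 + (1 - l) *: a t0) ut0 at0.
    by rewrite -scalerDl addrC subrK scale1r.
(* The factor 2 bounds [|a t - x0|], both vectors having norm at most 1. *)
have [n n_eps] : exists n, (2 / 3) ^+ n * 2 < eps.
  have e2 : 0 < eps / 2 by rewrite divr_gt0.
  have l1 : `|2 / 3 : R| < 1 by rewrite ger0_norm; lra.
  have [n _ /(_ n (leqnn n))] := @cvgr_dist_lt _ _ _ _ _ _ _ (cvg_expr l1) _ e2.
  rewrite /= sub0r normrN ger0_norm; last by apply: exprn_ge0; lra.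
  by move=> ?; exists n; rewrite -ltr_pdivlMr.
exists (b n); split.
  have [m [s [u [s0 s1 Su ->]]]] := conv_b n.
  exists m, s, u; split=> // i.
  exact: (unit_face_extreme K_compact normH).
have abE : a - b n = l ^+ n *: (a - cst x0).
  rewrite /b scalerBl scale1r scalerBr [X in a - X]addrC opprD opprB addrA.
  by rewrite subrKC.
(* Pointwise bounds only yield a non-strict bound on the supremum, so the strict inequality is taken
   from [n_eps]. *)
apply: le_lt_trans n_eps.
have cab : continuous (a - b n).
  rewrite abE => t; apply: cvgZ; first exact: cvg_cst.
  by apply: cvgB; [exact: ca | exact: cvg_cst].
apply/(supnorm_leP t0 _ K_compact cab) => t.
rewrite abE normrZ normrX (ger0_norm l0) rmorphM rmorphXn.
apply: ler_wpM2l; first by rewrite exprn_ge0.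
apply: le_trans (ler_normB _ _) _.
by rewrite x0_unit rmorph_nat lerD.
Qed.
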